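(* The function $f(r)=(1-\sqrt{r})^2\psi(r)/r$ is strictly decreasing from $(0,1)$ onto $(4/\pi,\pi)$. In particular, for all $r\in(0,1)$, $$\frac{4r}{\pi(1-\sqrt{r})^2}<\psi(r)<\frac{\pi r}{(1-\sqrt{r})^2}.$$
   Context: For $0<r<1$ let $\mathcal{K}(r)=\int_0^{\pi/2}\frac{dt}{\sqrt{1-r^2\sin^2t}}$ and $\mathcal{E}(r)=\int_0^{\pi/2}\sqrt{1-r^2\sin^2t}\,dt$ be the complete elliptic integrals of the first and second kind (argument is the modulus $r$). Put $r'=\sqrt{1-r^2}$, $\mathcal{K}'(r)=\mathcal{K}(r')$, $\mathcal{E}'(r)=\mathcal{E}(r')$ (the prime on $\mathcal{K},\mathcal{E}$ is not a derivative). The function $\psi:(0,1)\to(0,\infty)$ is defined by $$\psi(r)=\frac{2(\mathcal{E}(r)-(1-r)\mathcal{K}(r))}{\mathcal{E}'(r)-r\mathcal{K}'(r)}.$$ *)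

(* Defs.v *)
From Stdlib Require Export Reals.
From Coquelicot Require Export Coquelicot.
Open Scope R_scope.

(* In ellK and ellE the argument is the modulus r, not the
   parameter r^2. *)
Definition ellK (r : R) : R :=
  RInt (fun t => 1 / sqrt (1 - r ^ 2 * sin t ^ 2)) 0 (PI / 2).

Definition ellE (r : R) : R :=
  RInt (fun t => sqrt (1 - r ^ 2 * sin t ^ 2)) 0 (PI / 2).

(* Complementary modulus; the primes on K and E are not derivatives. *)
Definition cmod (r : R) : R := sqrt (1 - r ^ 2).

Definition ellK' (r : R) : R := ellK (cmod r).

Definition ellE' (r : R) : R := ellE (cmod r).

Definition psi (r : R) : R :=
  2 * (ellE r - (1 - r) * ellK r) / (ellE' r - r * ellK' r).

Definition fpsi (r : R) : R := (1 - sqrt r) ^ 2 * psi r / r.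

(* Main.v *)
(** Let [B k] be the integral of [cos ^ 2 / Delta] over [0, PI / 2], where
    [Delta = sqrt (1 - k ^ 2 * sin ^ 2)]; thus [E - k' ^ 2 K = k ^ 2 B].  Landen's
    transformation, up to multiples of the exact form [d (sin * cos / Delta)], turns both
    [E(r) - (1 - r) K(r)] and [E'(r) - r K'(r)] into multiples of [B], and with
    [u = sqrt r], [l = 2 u / (1 + u ^ 2)],
    [l' = (1 - u ^ 2) / (1 + u ^ 2)] one gets
    [f r = 4 / (1 + u) ^ 2 * (B l / B l')].  Since [l] and [l'] are complementary
    moduli, the estimate [B' k <= k / (2 k') * B k] bounds the logarithmic derivative
    of [f] in [u] by
    [- ((1 - u) ^ 3 + 2 u ^ 3 + 2 u ^ 4) / ((1 + u ^ 2) ^ 2 * (1 + u)) < 0].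
    The end values follow from [PI / 4 <= B k <= PI / (4 k')] and
    [1 - k' <= B k <= 1]. *)

Require Import Defs.
From Stdlib Require Import Reals.
From Coquelicot Require Import Coquelicot.
From Stdlib Require Import Ranalysis5 Lra.
Open Scope R_scope.

(** * Integration tools and the radical of modulus [k] *)

Lemma ex_RInt_everywhere (f : R -> R) (a b : R) :
  (forall t, continuous f t) -> ex_RInt f a b.
Proof. now intros Hf; apply (ex_RInt_continuous (V := R_CompleteNormedModule)). Qed.

Lemma continuous_of_derivable (f : R -> R) :
  (forall t, ex_derive f t) -> forall t, continuous f t.
Proof. now intros Hf t; apply (ex_derive_continuous (V := R_NormedModule)). Qed.

Lemma RInt_derive_everywhere (G g : R -> R) (a b : R) :
  (forall t, is_derive G t (g t)) -> (forall t, continuous g t) ->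
  RInt g a b = G b - G a :> R.
Proof.
intros HG Hg; apply is_RInt_unique.
now apply (is_RInt_derive (V := R_CompleteNormedModule) G g).
Qed.

(** Both Landen identities and the bound on the derivative of [ellB] compare integrands that agree
    only up to an exact derivative. A primitive with equal end values contributes nothing. *)
Lemma RInt_eq_modulo_derivative (f g G : R -> R) (a b : R) :
  (forall t, continuous f t) -> (forall t, continuous g t) ->
  (forall t, is_derive G t (f t - g t)) -> G a = G b ->
  RInt f a b = RInt g a b.
Proof.
intros Hf Hg HG Hab.
assert (H : RInt (fun t => f t - g t) a b = 0).
{ rewrite (RInt_derive_everywhere G).
  - change (G b - G a = 0 :> R); rewrite Hab; ring.
  - exact HG.
  - intros t; apply (continuous_minus (V := R_NormedModule) f g); auto. }
rewrite (RInt_minus (V := R_CompleteNormedModule) f g) in H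
  by now apply ex_RInt_everywhere.
unfold minus, plus, opp in H; simpl in H; lra.
Qed.

Lemma sin2_cos2_pow (t : R) : sin t ^ 2 = 1 - cos t ^ 2.
Proof. generalize (sin2_cos2 t); unfold Rsqr; lra. Qed.

Definition ellDelta (k t : R) : R := sqrt (1 - k ^ 2 * sin t ^ 2).

Lemma delta_sq (k q t : R) : k ^ 2 + q ^ 2 = 1 ->
  1 - k ^ 2 * sin t ^ 2 = cos t ^ 2 + q ^ 2 * sin t ^ 2.
Proof. intros H; rewrite (sin2_cos2_pow t); nra. Qed.

Lemma quadratic_form_pos (q t : R) : 0 < q -> 0 < cos t ^ 2 + q * sin t ^ 2.
Proof.
intros Hq; generalize (sin2_cos2_pow t) (pow2_ge_0 (sin t)) (pow2_ge_0 (cos t)).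
intros; destruct (Req_dec (cos t ^ 2) 0); nra.
Qed.

Lemma delta_sq_pos (k t : R) : k ^ 2 < 1 -> 0 < 1 - k ^ 2 * sin t ^ 2.
Proof.
intros Hk; generalize (sin2_cos2_pow t) (pow2_ge_0 (sin t)) (pow2_ge_0 (cos t)).
intros; nra.
Qed.

Lemma modulus_sq_lt_1 (k q : R) : k ^ 2 + q ^ 2 = 1 -> 0 < q -> k ^ 2 < 1.
Proof. intros H Hq; generalize (pow_lt q 2 Hq); lra. Qed.

Lemma ellDelta_pos (k t : R) : k ^ 2 < 1 -> 0 < ellDelta k t.
Proof. now intros Hk; apply sqrt_lt_R0, delta_sq_pos. Qed.

Lemma ellDelta_sq (k t : R) : k ^ 2 < 1 ->
  ellDelta k t ^ 2 = 1 - k ^ 2 * sin t ^ 2.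
Proof. now intros Hk; apply pow2_sqrt, Rlt_le, delta_sq_pos. Qed.

Lemma ellDelta_compl_pos (k q t : R) : k ^ 2 + q ^ 2 = 1 -> 0 < q ->
  0 < ellDelta k t.
Proof. now intros Hkq Hq; apply ellDelta_pos, (modulus_sq_lt_1 k q). Qed.

Lemma ellDelta_compl_sq (k q t : R) : k ^ 2 + q ^ 2 = 1 -> 0 < q ->
  ellDelta k t ^ 2 = cos t ^ 2 + q ^ 2 * sin t ^ 2.
Proof.
intros Hkq Hq; rewrite ellDelta_sq by now apply (modulus_sq_lt_1 k q).
now apply delta_sq.
Qed.

Definition ellB (k : R) : R :=
  RInt (fun t => cos t ^ 2 / ellDelta k t) 0 (PI / 2).

Lemma continuous_delta (k t : R) : k ^ 2 < 1 ->
  continuous (fun t => ellDelta k t) t.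
Proof.
intros Hk; revert t; apply continuous_of_derivable; intros t.
unfold ellDelta; auto_derive; generalize (delta_sq_pos k t Hk); lra.
Qed.

(** This is the exact form by which the Landen integrands are corrected; its primitive vanishes at 0
    and at [PI / 2]. *)
Lemma is_derive_sin_cos_div_delta (k q t : R) : k ^ 2 + q ^ 2 = 1 -> 0 < q ->
  is_derive (fun t => sin t * cos t / ellDelta k t) t
    ((cos t ^ 4 - q ^ 2 * sin t ^ 4) / ellDelta k t ^ 3).
Proof.
intros Hkq Hq.
assert (Hp : 0 < 1 - k ^ 2 * sin t ^ 2)
  by now apply delta_sq_pos, (modulus_sq_lt_1 k q).
assert (Hs := sqrt_lt_R0 _ Hp).
unfold ellDelta in Hs |- *; auto_derive;
  replace (1 + - (k * (k * 1) * (sin t * (sin t * 1))))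
    with (1 - k ^ 2 * sin t ^ 2) by ring.
- repeat split; lra.
- assert (E := sqrt_sqrt _ (Rlt_le _ _ Hp)).
  set (D := sqrt (1 - k ^ 2 * sin t ^ 2)) in *.
  field_simplify_eq; [| lra].
  assert (E2 : D ^ 2 = 1 - k ^ 2 * sin t ^ 2) by (rewrite <- E; ring).
  rewrite E2.
  replace (q ^ 2) with (1 - k ^ 2) by lra.
  replace (cos t ^ 4) with ((cos t ^ 2) ^ 2) by ring.
  replace (cos t ^ 2) with (1 - sin t ^ 2) by (rewrite sin2_cos2_pow; ring).
  ring.
Qed.

(** * Landen transformation *)

(* The smooth branch on the whole line of the angle given by
   [tan (landen_phi q t - t) = q * tan t]. *)
Definition landen_phi (q t : R) : R :=
  2 * t - atan ((1 - q) * (sin t * cos t) / (cos t ^ 2 + q * sin t ^ 2)).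

Definition landen_w (q t : R) : R := cos t ^ 2 + q * sin t ^ 2.

Section Landen.

Variables k q : R.
Hypothesis Hkq : k ^ 2 + q ^ 2 = 1.
Hypothesis Hq : 0 < q.

Local Notation D := (ellDelta k).
Local Notation w := (landen_w q).

Lemma landen_w_pos t : 0 < w t.
Proof. now apply quadratic_form_pos. Qed.

(** This is the secant of the arctangent in [landen_phi]. It rests on [w ^ 2 + (1 - q) ^ 2 * sin ^ 2
    * cos ^ 2 = (cos ^ 2 + q ^ 2 * sin ^ 2) * (cos ^ 2 + sin ^ 2)], whose right side is [D ^ 2]. *)
Lemma landen_sqrt_atan t :
  sqrt (1 + ((1 - q) * (sin t * cos t) / w t)²) = D t / w t.
Proof.
generalize (landen_w_pos t) (ellDelta_compl_pos k q t Hkq Hq); intros Hw HD.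
apply sqrt_lem_1.
- generalize (Rle_0_sqr ((1 - q) * (sin t * cos t) / w t)); lra.
- apply Rlt_le, Rdiv_lt_0_compat; lra.
- replace (D t / w t * (D t / w t)) with (D t ^ 2 / w t ^ 2) by (field; lra).
  rewrite (ellDelta_compl_sq k q) by assumption; unfold Rsqr.
  field_simplify_eq; [| lra]; unfold landen_w.
  rewrite sin2_cos2_pow; ring.
Qed.

Lemma sin_landen_phi t :
  sin (landen_phi q t) = (1 + q) * (sin t * cos t) / D t.
Proof.
generalize (landen_w_pos t) (ellDelta_compl_pos k q t Hkq Hq); intros Hw HD.
unfold landen_phi; change (cos t ^ 2 + q * sin t ^ 2) with (w t).
rewrite sin_minus, sin_atan, cos_atan, landen_sqrt_atan.
rewrite sin_2a, cos_2a.
field_simplify_eq; [| lra]; unfold landen_w.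
replace (cos t ^ 3) with (cos t ^ 2 * cos t) by ring.
replace (cos t ^ 2) with (1 - sin t ^ 2) by (rewrite sin2_cos2_pow; ring).
ring.
Qed.

Lemma cos_landen_phi t :
  cos (landen_phi q t) = (cos t ^ 2 - q * sin t ^ 2) / D t.
Proof.
generalize (landen_w_pos t) (ellDelta_compl_pos k q t Hkq Hq); intros Hw HD.
unfold landen_phi; change (cos t ^ 2 + q * sin t ^ 2) with (w t).
rewrite cos_minus, sin_atan, cos_atan, landen_sqrt_atan.
rewrite sin_2a, cos_2a.
field_simplify_eq; [| lra]; unfold landen_w.
replace (cos t ^ 4) with ((cos t ^ 2) ^ 2) by ring.
replace (cos t ^ 2) with (1 - sin t ^ 2) by (rewrite sin2_cos2_pow; ring).
ring.
Qed.

Lemma is_derive_landen_phi t :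
  is_derive (landen_phi q) t ((1 + q) * w t / D t ^ 2).
Proof.
generalize (landen_w_pos t) (ellDelta_compl_pos k q t Hkq Hq); intros Hw HD.
unfold landen_phi; auto_derive.
- revert Hw; unfold landen_w; simpl; lra.
- rewrite (ellDelta_compl_sq k q) by assumption.
  assert (Hp : 0 < cos t ^ 2 + q ^ 2 * sin t ^ 2)
    by (apply quadratic_form_pos, pow_lt, Hq).
  assert (HW : 0 < cos t ^ 2 + q * sin t ^ 2) by exact Hw.
  unfold landen_w; unfold Rsqr.
  (* [X] is the denominator produced by differentiating [atan]; it equals [D t ^ 2 / w t ^ 2],
     written out in sines and cosines. *)
  set (X := 1 + _ * _).
  assert (EX : X = (cos t ^ 2 + q ^ 2 * sin t ^ 2) / (cos t ^ 2 + q * sin t ^ 2) ^ 2).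
  { unfold X; simpl; field_simplify_eq; [| simpl in *; lra].
    replace (sin t ^ 4) with ((sin t ^ 2) ^ 2) by ring.
    rewrite sin2_cos2_pow; ring. }
  clearbody X; subst X.
  simpl; field_simplify_eq; [| simpl in *; lra].
  replace (sin t ^ 6) with ((sin t ^ 2) ^ 3) by ring.
  replace (sin t ^ 4) with ((sin t ^ 2) ^ 2) by ring.
  rewrite sin2_cos2_pow; ring.
Qed.

(** The arctangent in [landen_phi] vanishes at 0 and at [PI / 2], so the new angle runs from 0 to
    [PI] while [t] covers only a quarter period. *)
Lemma RInt_landen (F : R -> R) :
  (forall x, continuous F x) ->
  RInt F 0 PI =
  RInt (fun t => (1 + q) * w t / D t ^ 2 * F (landen_phi q t)) 0 (PI / 2).
Proof.
intros HF.
replace PI with (landen_phi q (PI / 2)) at 1.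
replace 0 with (landen_phi q 0) at 1.
- symmetry; apply (RInt_comp (V := R_CompleteNormedModule)).
  + intros; apply HF.
  + intros x _; split; [apply is_derive_landen_phi |].
    revert x; apply continuous_of_derivable; intros x.
    unfold landen_w, ellDelta; auto_derive.
    change (1 + - (k * (k * 1) * (sin x * (sin x * 1))))
      with (1 - k ^ 2 * sin x ^ 2).
    change (sqrt (1 - k ^ 2 * sin x ^ 2)) with (D x).
    generalize (ellDelta_compl_pos k q x Hkq Hq) (delta_sq_pos k x (modulus_sq_lt_1 k q Hkq Hq)).
    intros; repeat split; [lra |]; apply Rgt_not_eq; nra.
- unfold landen_phi; unfold Rdiv.
  rewrite sin_0, Rmult_0_l, !Rmult_0_r, Rmult_0_l, atan_0; ring.
- unfold landen_phi; rewrite cos_PI2; unfold Rdiv.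
  rewrite !Rmult_0_r, Rmult_0_l, atan_0; field.
Qed.

(** By the formula for the sine of the new angle, the radicand is [(D ^ 2 - (1 - q) ^ 2 * sin ^ 2 *
    cos ^ 2) / D ^ 2], and the identity behind [landen_sqrt_atan] makes its numerator the perfect
    square [w ^ 2]. The radical of the lower modulus is thus rational in [sin], [cos] and [D]. *)
Lemma landen_delta t :
  sqrt (1 - ((1 - q) / (1 + q)) ^ 2 * sin (landen_phi q t) ^ 2) = w t / D t.
Proof.
generalize (landen_w_pos t) (ellDelta_compl_pos k q t Hkq Hq)
  (ellDelta_compl_sq k q t Hkq Hq); intros Hw HD HD2.
assert (Hr : 0 <= w t / D t) by (apply Rlt_le, Rdiv_lt_0_compat; lra).
rewrite <- (sqrt_pow2 (w t / D t)) by exact Hr; f_equal.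
rewrite sin_landen_phi.
field_simplify_eq; [| lra].
rewrite HD2; unfold landen_w.
replace (cos t ^ 4) with ((cos t ^ 2) ^ 2) by ring.
replace (cos t ^ 2) with (1 - sin t ^ 2) by (rewrite sin2_cos2_pow; ring).
ring.
Qed.

End Landen.

(** Landen's substitution produces integrals over [[0, PI]]; this returns them to the quarter period
    on which the elliptic integrals are defined. *)
Lemma RInt_0_PI_symmetric (F : R -> R) :
  (forall x, continuous F x) -> (forall x, F (PI - x) = F x) ->
  RInt F 0 PI = 2 * RInt F 0 (PI / 2).
Proof.
intros HF Hsym.
rewrite <- (RInt_Chasles (V := R_CompleteNormedModule) F 0 (PI / 2) PI)
  by now apply ex_RInt_everywhere.
assert (H : RInt F (PI / 2) PI = RInt F 0 (PI / 2)).
{ rewrite <- (opp_RInt_swap (V := R_CompleteNormedModule))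
    by now apply ex_RInt_everywhere.
  replace (PI / 2) with (PI - PI / 2) at 1 by field.
  replace PI with (PI - 0) at 1 by ring.
  rewrite <- (RInt_comp (V := R_CompleteNormedModule) F (fun x => PI - x) (fun _ => -1)).
  - rewrite <- (RInt_opp (V := R_CompleteNormedModule)).
    + apply RInt_ext; intros x _.
      unfold scal, opp; simpl; unfold mult; simpl; rewrite Hsym; ring.
    + apply ex_RInt_everywhere; intros x.
      apply (continuous_scal (K := R_AbsRing) (V := R_NormedModule)
        (fun _ => -1) (fun x => F (PI - x))); [apply continuous_const |].
      apply (continuous_ext F); [now intros; rewrite Hsym | apply HF].
  - intros; apply HF.
  - intros x _; split; [auto_derive; [exact I | ring] | apply continuous_const]. }
rewrite H; unfold plus; simpl; ring.
Qed.

Lemma ex_derive_ellDelta (k t : R) : k ^ 2 < 1 -> ex_derive (ellDelta k) t.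
Proof.
intros Hk; unfold ellDelta; auto_derive.
generalize (delta_sq_pos k t Hk); lra.
Qed.

(** Continuity is deduced from differentiability. The remaining side conditions concern products of
    [ellDelta] and of the 1 that ends an unfolded power. *)
Ltac ellDelta_continuity Hk :=
  intros; apply (ex_derive_continuous (V := R_NormedModule)); auto_derive;
  repeat split; trivial; try (now apply ex_derive_ellDelta);
  repeat apply Rmult_integral_contrapositive_currified;
  first [apply Rgt_not_eq, ellDelta_pos, Hk | apply R1_neq_R0].

(** Writing [ellDelta] as [ellDelta ^ 2 / ellDelta] merges the two integrals into one. The numerator
    of [psi] takes [a = 1 - r], the denominator takes [a] equal to the complementary modulus. *)
Lemma ellE_minus_ellK (k a : R) : k ^ 2 < 1 ->
  ellE k - a * ellK k =
  RInt (fun t => (1 - a - k ^ 2 * sin t ^ 2) / ellDelta k t) 0 (PI / 2).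
Proof.
intros Hk.
assert (HK : forall t, continuous (fun t => 1 / ellDelta k t) t)
  by ellDelta_continuity Hk.
assert (HE : forall t, continuous (ellDelta k) t)
  by now intros; apply continuous_delta.
symmetry; transitivity
  (RInt (fun t => minus (ellDelta k t) (scal a (1 / ellDelta k t))) 0 (PI / 2)).
- apply RInt_ext; intros t _.
  change ((1 - a - k ^ 2 * sin t ^ 2) / ellDelta k t
    = ellDelta k t - a * (1 / ellDelta k t)).
  replace (1 - a - k ^ 2 * sin t ^ 2) with (ellDelta k t ^ 2 - a)
    by (rewrite ellDelta_sq by exact Hk; ring).
  field; apply Rgt_not_eq, ellDelta_pos, Hk.
- rewrite (RInt_minus (V := R_CompleteNormedModule)).
  + rewrite (RInt_scal (V := R_CompleteNormedModule)).
    * reflexivity.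
    * now apply ex_RInt_everywhere.
  + now apply ex_RInt_everywhere.
  + apply ex_RInt_everywhere; intros t.
    now apply (continuous_scal_r (K := R_AbsRing) (V := R_NormedModule) a).
Qed.

Lemma landen_modulus_sq_lt_1 (q : R) : 0 < q -> ((1 - q) / (1 + q)) ^ 2 < 1.
Proof.
intros Hq; apply Rminus_lt_0.
replace (1 - ((1 - q) / (1 + q)) ^ 2) with (4 * q / (1 + q) ^ 2) by (field; lra).
apply Rdiv_lt_0_compat; nra.
Qed.

(** The integral of the lower modulus [r] is carried up to modulus [k]. It is applied with
    [q = landen_down u], for which [r = u ^ 2]. *)
Lemma landen_numerator (k q : R) : k ^ 2 + q ^ 2 = 1 -> 0 < q ->
  let r := (1 - q) / (1 + q) in
  ellE r - (1 - r) * ellK r = (1 - q) * ellB k.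
Proof.
intros Hkq Hq r.
assert (Hr : r ^ 2 < 1) by now apply landen_modulus_sq_lt_1.
assert (Hk : k ^ 2 < 1) by now apply (modulus_sq_lt_1 k q).
rewrite ellE_minus_ellK by exact Hr.
set (F := fun t => (1 - (1 - r) - r ^ 2 * sin t ^ 2) / ellDelta r t).
assert (HF : forall x, continuous F x).
{ unfold F; ellDelta_continuity Hr. }
apply (Rmult_eq_reg_l 2); [| lra].
rewrite <- RInt_0_PI_symmetric; [| exact HF |].
2:{ intros x; unfold F, ellDelta; now rewrite sin_PI_x. }
rewrite (RInt_landen k q) by assumption.
unfold ellB; rewrite <- Rmult_assoc.
rewrite <- (RInt_scal (V := R_CompleteNormedModule) _ _ _ (2 * (1 - q))).
2:{ apply ex_RInt_everywhere; ellDelta_continuity Hk. }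
(* The factor [w] of the Jacobian cancels against the new radical [w / D], which leaves a polynomial
   in [sin] and [cos] over [D ^ 3]. *)
assert (Hform : forall t, (1 + q) * landen_w q t / ellDelta k t ^ 2 * F (landen_phi q t)
  = (1 - q) * (cos t ^ 4 + q ^ 2 * sin t ^ 2 * (1 + cos t ^ 2)) / ellDelta k t ^ 3).
{ intros t; unfold F, r.
  generalize (ellDelta_compl_pos k q t Hkq Hq) (landen_w_pos q Hq t)
    (ellDelta_compl_sq k q t Hkq Hq); intros HD Hw HD2.
  change (ellDelta ?a ?b) with (sqrt (1 - a ^ 2 * sin b ^ 2)) at 2.
  rewrite (landen_delta k q), sin_landen_phi with (k := k) by assumption.
  field_simplify_eq; [| lra].
  rewrite HD2.
  replace (cos t ^ 4) with ((cos t ^ 2) ^ 2) by ring.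
  replace (cos t ^ 2) with (1 - sin t ^ 2) by (rewrite sin2_cos2_pow; ring).
  ring. }
etransitivity; [apply RInt_ext; intros t _; apply Hform |].
(* The coefficient is found by comparing the two integrands at [t = 0]: [(1 - q) - 2 * (1 - q)]. *)
apply (RInt_eq_modulo_derivative _ _
  (fun t => - (1 - q) * (sin t * cos t / ellDelta k t))).
- ellDelta_continuity Hk.
- unfold scal; simpl; unfold mult; simpl; ellDelta_continuity Hk.
- intros t.
  match goal with |- is_derive _ _ ?e => replace e with
    (- (1 - q) * ((cos t ^ 4 - q ^ 2 * sin t ^ 4) / ellDelta k t ^ 3)) end.
  + now apply is_derive_scal, is_derive_sin_cos_div_delta.
  + change (scal ?a ?b) with (a * b).
    generalize (ellDelta_compl_pos k q t Hkq Hq) (ellDelta_compl_sq k q t Hkq Hq); intros HD HD2.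
    field_simplify_eq; [| lra].
    rewrite HD2.
    replace (cos t ^ 4) with ((cos t ^ 2) ^ 2) by ring.
    replace (cos t ^ 2) with (1 - sin t ^ 2) by (rewrite sin2_cos2_pow; ring).
    ring.
- rewrite sin_0, cos_PI2; unfold Rdiv; ring.
Qed.

(** Here the substitution acts on the right side: the integrand of [ellB] at the lower modulus is
    carried up to [k]. It is applied with [q = u ^ 2], where the lower modulus is
    [landen_down u]. *)
Lemma landen_denominator (k q : R) : k ^ 2 + q ^ 2 = 1 -> 0 < q ->
  ellE k - q * ellK k =
  (1 - q) ^ 2 / (1 + q) * ellB ((1 - q) / (1 + q)).
Proof.
intros Hkq Hq; set (r := (1 - q) / (1 + q)).
assert (Hr : r ^ 2 < 1) by now apply landen_modulus_sq_lt_1.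
assert (Hk : k ^ 2 < 1) by now apply (modulus_sq_lt_1 k q).
rewrite ellE_minus_ellK by exact Hk.
set (F := fun t => cos t ^ 2 / ellDelta r t).
assert (HF : forall x, continuous F x) by (unfold F; ellDelta_continuity Hr).
replace (ellB r) with (RInt F 0 PI / 2).
2:{ rewrite RInt_0_PI_symmetric; [unfold ellB; fold F; field | exact HF |].
    intros x; unfold F, ellDelta; rewrite sin_PI_x, Rtrigo_facts.cos_pi_minus; f_equal; ring. }
rewrite (RInt_landen k q) by assumption.
assert (Hform : forall t, (1 + q) * landen_w q t / ellDelta k t ^ 2 * F (landen_phi q t)
  = (1 + q) * (cos t ^ 2 - q * sin t ^ 2) ^ 2 / ellDelta k t ^ 3).
{ intros t; unfold F, r.
  generalize (ellDelta_compl_pos k q t Hkq Hq) (landen_w_pos q Hq t); intros HD Hw.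
  change (ellDelta ?a ?b) with (sqrt (1 - a ^ 2 * sin b ^ 2)) at 2.
  rewrite (landen_delta k q), cos_landen_phi with (k := k) by assumption.
  field; lra. }
rewrite (RInt_ext _ _ _ _ (fun t _ => Hform t)).
match goal with |- _ = _ * (?J / 2) =>
  replace ((1 - q) ^ 2 / (1 + q) * (J / 2))
    with ((1 - q) ^ 2 / (1 + q) / 2 * J) by (field; lra) end.
rewrite <- (RInt_scal (V := R_CompleteNormedModule)).
2:{ apply ex_RInt_everywhere; ellDelta_continuity Hk. }
(* Comparison at [t = 0] again gives the coefficient: [(1 - q) - (1 - q) ^ 2 / 2 = (1 - q ^ 2) /
   2]. *)
apply (RInt_eq_modulo_derivative _ _
  (fun t => (1 - q ^ 2) / 2 * (sin t * cos t / ellDelta k t))).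
- ellDelta_continuity Hk.
- unfold scal; simpl; unfold mult; simpl; ellDelta_continuity Hk.
- intros t.
  match goal with |- is_derive _ _ ?e => replace e with
    ((1 - q ^ 2) / 2 * ((cos t ^ 4 - q ^ 2 * sin t ^ 4) / ellDelta k t ^ 3)) end.
  + now apply is_derive_scal, is_derive_sin_cos_div_delta.
  + change (scal ?a ?b) with (a * b).
    generalize (ellDelta_compl_pos k q t Hkq Hq) (ellDelta_compl_sq k q t Hkq Hq); intros HD HD2.
    replace (k ^ 2) with (1 - q ^ 2) by lra.
    field_simplify_eq; [| lra].
    rewrite HD2.
    replace (cos t ^ 4) with ((cos t ^ 2) ^ 2) by ring.
    replace (cos t ^ 2) with (1 - sin t ^ 2) by (rewrite sin2_cos2_pow; ring).
    ring.
- rewrite sin_0, cos_PI2; unfold Rdiv; ring.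
Qed.

(** * Bounds and derivative of [ellB] *)

Lemma RInt_cos_sq : RInt (fun t => cos t ^ 2) 0 (PI / 2) = PI / 4 :> R.
Proof.
rewrite (RInt_derive_everywhere (fun t => (t + sin t * cos t) / 2)).
- rewrite sin_0, cos_PI2; field.
- intros t; auto_derive; [exact I |].
  generalize (sin2_cos2_pow t); simpl; lra.
- intros t; apply continuous_of_derivable; intros; auto_derive; exact I.
Qed.

Lemma ex_RInt_ellB (k : R) : k ^ 2 < 1 ->
  ex_RInt (fun t => cos t ^ 2 / ellDelta k t) 0 (PI / 2).
Proof. intros Hk; apply ex_RInt_everywhere; ellDelta_continuity Hk. Qed.

Lemma sin_cos_pos (t : R) : 0 < t < PI / 2 -> 0 < sin t /\ 0 < cos t.
Proof.
intros Ht; split; [apply sin_gt_0 | apply cos_gt_0]; generalize PI_RGT_0; lra.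
Qed.

(** The radical is at most 1. This bound is sharp as [k] tends to 0. *)
Lemma ellB_ge_PI4 (k : R) : k ^ 2 < 1 -> PI / 4 <= ellB k.
Proof.
intros Hk; rewrite <- RInt_cos_sq; apply RInt_le.
- generalize PI_RGT_0; lra.
- apply ex_RInt_everywhere, continuous_of_derivable; intros; auto_derive; exact I.
- now apply ex_RInt_ellB.
- intros t _.
  generalize (ellDelta_pos k t Hk) (ellDelta_sq k t Hk) (pow2_ge_0 k)
    (pow2_ge_0 (sin t)) (pow2_ge_0 (cos t)); intros.
  apply -> Rle_div_r; [| lra].
  assert (ellDelta k t <= 1) by nra; nra.
Qed.

(** Since [ellDelta ^ 2 - cos ^ 2 = (1 - k ^ 2) * sin ^ 2], the radical is at least [cos] and the
    integrand at most [cos]. This bound is sharp as [k] tends to 1. *)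
Lemma ellB_le_1 (k : R) : k ^ 2 < 1 -> ellB k <= 1.
Proof.
intros Hk.
replace 1 with (RInt cos 0 (PI / 2)).
2:{ rewrite (RInt_derive_everywhere sin).
    - now rewrite sin_PI2, sin_0, Rminus_0_r.
    - intros; auto_derive; [exact I | ring].
    - apply continuous_of_derivable; intros; auto_derive; exact I. }
apply RInt_le.
- generalize PI_RGT_0; lra.
- now apply ex_RInt_ellB.
- apply ex_RInt_everywhere, continuous_of_derivable; intros; auto_derive; exact I.
- intros t Ht; destruct (sin_cos_pos t Ht) as [Hs Hc].
  generalize (ellDelta_pos k t Hk) (ellDelta_sq k t Hk) (sin2_cos2_pow t)
    (pow2_ge_0 k); intros.
  apply <- Rle_div_l; [| lra].
  assert (cos t <= ellDelta k t) by nra; nra.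
Qed.

(** The radical is at least [q]. Together with the lower bound [PI / 4] this fixes the limit of
    [ellB] at 0. *)
Lemma ellB_le_div (k q : R) : k ^ 2 + q ^ 2 = 1 -> 0 < q -> ellB k <= PI / 4 / q.
Proof.
intros Hkq Hq; assert (Hk := modulus_sq_lt_1 k q Hkq Hq).
replace (PI / 4 / q) with (RInt (fun t => / q * cos t ^ 2) 0 (PI / 2)).
2:{ rewrite (RInt_scal (V := R_CompleteNormedModule)).
    - rewrite RInt_cos_sq; unfold scal; simpl; unfold mult; simpl; field; lra.
    - apply ex_RInt_everywhere, continuous_of_derivable; intros; auto_derive; exact I. }
apply RInt_le.
- generalize PI_RGT_0; lra.
- now apply ex_RInt_ellB.
- apply ex_RInt_everywhere, continuous_of_derivable; intros; auto_derive; exact I.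
- intros t _.
  generalize (ellDelta_compl_pos k q t Hkq Hq) (ellDelta_compl_sq k q t Hkq Hq)
    (sin2_cos2_pow t) (pow2_ge_0 (cos t)) (pow2_ge_0 k); intros HD HD2 Hsc Hc Hk0.
  apply <- Rle_div_l; [| lra].
  assert (q <= ellDelta k t) by nra.
  apply (Rmult_le_reg_l q); [lra |].
  replace (q * (/ q * cos t ^ 2 * ellDelta k t)) with (cos t ^ 2 * ellDelta k t)
    by (field; lra).
  nra.
Qed.

(** The radical is the norm of [(cos, q * sin)], hence at most [cos + q * sin], so the integrand is
    at least [cos - q * sin]. Together with the upper bound 1 this fixes the limit of [ellB] as [k]
    tends to 1. *)
Lemma ellB_ge_sub (k q : R) : k ^ 2 + q ^ 2 = 1 -> 0 < q -> 1 - q <= ellB k.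
Proof.
intros Hkq Hq; assert (Hk := modulus_sq_lt_1 k q Hkq Hq).
replace (1 - q) with (RInt (fun t => cos t - q * sin t) 0 (PI / 2)).
2:{ rewrite (RInt_derive_everywhere (fun t => sin t + q * cos t)).
    - rewrite sin_PI2, sin_0, cos_PI2, cos_0; change (1 + q * 0 - (0 + q * 1) = 1 - q :> R); ring.
    - intros; auto_derive; [exact I | ring].
    - apply continuous_of_derivable; intros; auto_derive; exact I. }
apply RInt_le.
- generalize PI_RGT_0; lra.
- apply ex_RInt_everywhere, continuous_of_derivable; intros; auto_derive; exact I.
- now apply ex_RInt_ellB.
- intros t Ht; destruct (sin_cos_pos t Ht) as [Hs Hc].
  generalize (ellDelta_compl_pos k q t Hkq Hq) (ellDelta_compl_sq k q t Hkq Hq); intros HD HD2.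
  apply -> Rle_div_r; [| lra].
  assert (0 < q * sin t) by now apply Rmult_lt_0_compat.
  set (qs := q * sin t) in *.
  assert (HD3 : ellDelta k t ^ 2 = cos t ^ 2 + qs ^ 2) by (rewrite HD2; unfold qs; ring).
  assert (ellDelta k t <= cos t + qs) by nra.
  (* If [cos t <= qs], the left side is nonpositive; otherwise it is at most
     [(cos t - qs) * (cos t + qs)]. *)
  destruct (Rle_or_lt (cos t) qs); nra.
Qed.

Definition ellB_deriv (k : R) : R :=
  RInt (fun t => k * sin t ^ 2 * cos t ^ 2 / ellDelta k t ^ 3) 0 (PI / 2).

Lemma locally_sq_lt_1 (k : R) : k ^ 2 < 1 -> locally k (fun u => u ^ 2 < 1).
Proof.
apply (open_comp (fun u : R => u ^ 2) (fun y => y < 1)); [| apply open_lt].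
intros u _; apply (ex_derive_continuous (V := R_NormedModule)); auto_derive; exact I.
Qed.

Lemma is_derive_ellB_integrand (k t : R) : k ^ 2 < 1 ->
  is_derive (fun u => cos t ^ 2 / ellDelta u t) k
    (k * sin t ^ 2 * cos t ^ 2 / ellDelta k t ^ 3).
Proof.
intros Hk.
assert (Hp := delta_sq_pos k t Hk); assert (Hs := ellDelta_pos k t Hk).
unfold ellDelta in *; auto_derive;
  replace (1 + - (k * (k * 1) * (sin t * (sin t * 1))))
    with (1 - k ^ 2 * sin t ^ 2) by ring.
- repeat split; lra.
- field; lra.
Qed.

Lemma continuity_2d_ellB_deriv_integrand (k t : R) : k ^ 2 < 1 ->
  continuity_2d_pt (fun u v => u * sin v ^ 2 * cos v ^ 2 / ellDelta u v ^ 3) k t.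
Proof.
intros Hk.
assert (Hsin : continuity_2d_pt (fun _ v => sin v) k t)
  by (apply (continuity_1d_2d_pt_comp sin);
      [apply continuity_sin | apply continuity_2d_pt_id2]).
assert (Hcos : continuity_2d_pt (fun _ v => cos v) k t)
  by (apply (continuity_1d_2d_pt_comp cos);
      [apply continuity_cos | apply continuity_2d_pt_id2]).
assert (HD : continuity_2d_pt ellDelta k t).
{ apply (continuity_1d_2d_pt_comp sqrt).
  - apply continuity_pt_sqrt, Rlt_le, delta_sq_pos, Hk.
  - simpl; repeat first [apply continuity_2d_pt_minus | apply continuity_2d_pt_mult
      | apply continuity_2d_pt_const | apply continuity_2d_pt_id1 | exact Hsin]. }
apply continuity_2d_pt_mult.
- simpl; repeat first [apply continuity_2d_pt_mult
    | apply continuity_2d_pt_const | apply continuity_2d_pt_id1 | exact Hsin | exact Hcos].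
- apply continuity_2d_pt_inv.
  + simpl; repeat first [apply continuity_2d_pt_mult
      | apply continuity_2d_pt_const | exact HD].
  + apply pow_nonzero, Rgt_not_eq, ellDelta_pos, Hk.
Qed.

Lemma is_derive_ellB (k : R) : k ^ 2 < 1 -> is_derive ellB k (ellB_deriv k).
Proof.
intros Hk; assert (Hloc := locally_sq_lt_1 k Hk).
evar_last.
- apply (is_derive_RInt_param (fun u t => cos t ^ 2 / ellDelta u t)).
  + apply filter_imp with (2 := Hloc); intros u Hu t _.
    eexists; now apply is_derive_ellB_integrand.
  + intros t _.
    (* The partial derivative is known in closed form where [u ^ 2 < 1], hence near [k], so joint
       continuity is transferred locally from the closed form. *)
    apply continuity_2d_pt_ext_loc with
      (f := fun u v => u * sin v ^ 2 * cos v ^ 2 / ellDelta u v ^ 3).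
    * destruct Hloc as [d Hd]; exists d; intros u v Hu _.
      symmetry; apply is_derive_unique, is_derive_ellB_integrand, Hd, Hu.
    * now apply continuity_2d_ellB_deriv_integrand.
  + apply filter_imp with (2 := Hloc); intros u Hu; now apply ex_RInt_ellB.
- apply RInt_ext; intros t _.
  now apply is_derive_unique, is_derive_ellB_integrand.
Qed.

(* [ellDelta ^ 2 >= 2 * q * sin * cos] reduces the left side to
   [sin * cos / ellDelta / (2 * q)].  Then [cos / ellDelta] and [cos - sin] both
   decrease, the latter vanishing at [PI / 4], where [cos / ellDelta] is
   [1 / sqrt (1 + q ^ 2)]; the subtracted term integrates to 0. *)
Lemma ellB_deriv_integrand_le (k q t : R) :
  k ^ 2 + q ^ 2 = 1 -> 0 < q -> 0 < t < PI / 2 ->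
  sin t ^ 2 * cos t ^ 2 / ellDelta k t ^ 3 <=
  (cos t ^ 2 / ellDelta k t - (cos t - sin t) / sqrt (1 + q ^ 2)) / (2 * q).
Proof.
intros Hkq Hq Ht; destruct (sin_cos_pos t Ht) as [Hs Hc].
generalize (ellDelta_compl_pos k q t Hkq Hq) (ellDelta_compl_sq k q t Hkq Hq); intros HD HD2.
set (D := ellDelta k t) in *; set (s := sin t) in *; set (c := cos t) in *.
assert (Hq2 := pow_lt q 2 Hq).
assert (HV : 0 < sqrt (1 + q ^ 2)) by (apply sqrt_lt_R0; lra).
assert (HV2 : sqrt (1 + q ^ 2) ^ 2 = 1 + q ^ 2) by (apply pow2_sqrt; lra).
set (V := sqrt (1 + q ^ 2)) in *.
assert (Hsc : 0 < s * c) by now apply Rmult_lt_0_compat.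
apply Rle_trans with (s * c / D / (2 * q)).
- apply Rminus_le_0.
  replace (s * c / D / (2 * q) - s ^ 2 * c ^ 2 / D ^ 3)
    with (s * c * (D ^ 2 - 2 * q * s * c) / (2 * q * D ^ 3)) by (field; lra).
  apply Rdiv_le_0_compat.
  + apply Rmult_le_pos; [lra |].
    rewrite HD2; generalize (pow2_ge_0 (c - q * s)); nra.
  + apply Rmult_lt_0_compat; [lra | now apply pow_lt].
- apply Rmult_le_compat_r; [apply Rlt_le, Rinv_0_lt_compat; lra |].
  apply Rminus_le_0.
  (* Expanding by the conjugate [c * V + D] removes the radicals from the numerator, which becomes
     [q ^ 2 * (c - s) ^ 2 * (c + s)]. *)
  replace (c ^ 2 / D - (c - s) / V - s * c / D)
    with ((c - s) * (c * V - D) * (c * V + D) / ((c * V + D) * (D * V)))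
    by (field; repeat split; try lra; apply Rgt_not_eq; nra).
  apply Rdiv_le_0_compat.
  + replace ((c - s) * (c * V - D) * (c * V + D))
      with ((c - s) * (c ^ 2 * V ^ 2 - D ^ 2)) by ring.
    rewrite HV2, HD2.
    replace ((c - s) * (c ^ 2 * (1 + q ^ 2) - (c ^ 2 + q ^ 2 * s ^ 2)))
      with (q ^ 2 * (c - s) ^ 2 * (c + s)) by ring.
    apply Rmult_le_pos; [| lra].
    apply Rmult_le_pos; [lra | apply pow2_ge_0].
  + repeat apply Rmult_lt_0_compat; try assumption; nra.
Qed.

Lemma ellB_deriv_le (k q : R) : 0 < k -> k ^ 2 + q ^ 2 = 1 -> 0 < q ->
  ellB_deriv k <= k / (2 * q) * ellB k.
Proof.
intros Hk0 Hkq Hq; assert (Hk := modulus_sq_lt_1 k q Hkq Hq).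
unfold ellB.
rewrite <- (RInt_scal (V := R_CompleteNormedModule)) by now apply ex_RInt_ellB.
assert (HV : sqrt (1 + q ^ 2) <> 0)
  by (apply Rgt_not_eq, sqrt_lt_R0; generalize (pow2_ge_0 q); lra).
set (V := sqrt (1 + q ^ 2)) in *.
assert (Hcont : forall t, continuous
  (fun t => k / (2 * q) * (cos t ^ 2 / ellDelta k t - (cos t - sin t) / V)) t)
  by ellDelta_continuity Hk.
(* The subtracted term has a multiple of [sin + cos] as primitive, and [sin + cos] is 1 at both
   ends. *)
rewrite <- (RInt_eq_modulo_derivative
  (fun t => k / (2 * q) * (cos t ^ 2 / ellDelta k t - (cos t - sin t) / V)) _
  (fun t => - (k / (2 * q) / V) * (sin t + cos t))).
- apply RInt_le.
  + generalize PI_RGT_0; lra.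
  + apply ex_RInt_everywhere; ellDelta_continuity Hk.
  + now apply ex_RInt_everywhere.
  + intros t Ht.
    replace (k * sin t ^ 2 * cos t ^ 2 / ellDelta k t ^ 3)
      with (k * (sin t ^ 2 * cos t ^ 2 / ellDelta k t ^ 3)) by (unfold Rdiv; ring).
    unfold Rdiv at 2; rewrite Rmult_assoc; apply Rmult_le_compat_l; [lra |].
    rewrite (Rmult_comm (/ (2 * q))); now apply ellB_deriv_integrand_le.
- exact Hcont.
- unfold scal; simpl; unfold mult; simpl; ellDelta_continuity Hk.
- intros t; change (scal ?a ?b) with (a * b); auto_derive; [exact I |].
  field; repeat split; try lra; apply Rgt_not_eq, ellDelta_pos, Hk.
- rewrite sin_0, cos_0, sin_PI2, cos_PI2; ring.
Qed.

(** * Monotonicity and range *)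

(** This is the ascending Landen modulus of [r = u ^ 2]. Its complement [landen_down u] is the
    descending Landen modulus of [cmod r]. *)
Definition landen_up (u : R) : R := 2 * u / (1 + u ^ 2).

Definition landen_down (u : R) : R := (1 - u ^ 2) / (1 + u ^ 2).

Definition gpsi (u : R) : R :=
  4 / (1 + u) ^ 2 * (ellB (landen_up u) / ellB (landen_down u)).

Lemma landen_complementary (u : R) : landen_up u ^ 2 + landen_down u ^ 2 = 1.
Proof. unfold landen_up, landen_down; field; nra. Qed.

Lemma landen_up_pos (u : R) : 0 < u -> 0 < landen_up u.
Proof. intros Hu; apply Rdiv_lt_0_compat; nra. Qed.

Lemma landen_down_pos (u : R) : 0 < u < 1 -> 0 < landen_down u.
Proof. intros Hu; apply Rdiv_lt_0_compat; nra. Qed.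

Lemma landen_up_sq_lt_1 (u : R) : 0 < u < 1 -> landen_up u ^ 2 < 1.
Proof.
intros Hu; apply (modulus_sq_lt_1 _ (landen_down u)).
- apply landen_complementary.
- now apply landen_down_pos.
Qed.

Lemma landen_down_sq_lt_1 (u : R) : 0 < u -> landen_down u ^ 2 < 1.
Proof.
intros Hu; apply (modulus_sq_lt_1 _ (landen_up u)).
- rewrite Rplus_comm; apply landen_complementary.
- now apply landen_up_pos.
Qed.

Lemma ellB_pos (k : R) : k ^ 2 < 1 -> 0 < ellB k.
Proof. intros Hk; generalize (ellB_ge_PI4 k Hk) PI_RGT_0; lra. Qed.

(** The numerator of [psi] carries [2 * (1 - landen_down u) = 4 * u ^ 2 / (1 + u ^ 2)] and the
    denominator [(1 - u ^ 2) ^ 2 / (1 + u ^ 2)]; the prefactor [(1 - u) ^ 2 / u ^ 2] leaves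
    [4 / (1 + u) ^ 2]. *)
Lemma fpsi_gpsi (u : R) : 0 < u < 1 -> fpsi (u ^ 2) = gpsi u.
Proof.
intros Hu; unfold fpsi, psi, gpsi, ellE', ellK'.
rewrite sqrt_pow2 by lra.
assert (H1 : 1 - u ^ 2 <> 0) by nra.
assert (H2 : 1 + u ^ 2 <> 0) by nra.
assert (Hcmod : cmod (u ^ 2) ^ 2 + (u ^ 2) ^ 2 = 1).
{ unfold cmod; rewrite pow2_sqrt; [ring |].
  replace (1 - (u ^ 2) ^ 2) with ((1 - u ^ 2) * (1 + u ^ 2)) by ring; nra. }
rewrite (landen_denominator (cmod (u ^ 2)) (u ^ 2) Hcmod) by nra.
assert (Hnum := landen_numerator (landen_up u) (landen_down u)
  (landen_complementary u) (landen_down_pos u Hu)).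
cbv zeta in Hnum.
replace ((1 - landen_down u) / (1 + landen_down u)) with (u ^ 2) in Hnum
  by (unfold landen_down; field; split; [nra |];
      replace (1 + u ^ 2 + (1 - u ^ 2)) with 2 by ring; lra).
rewrite Hnum; fold (landen_down u).
assert (HB := ellB_pos _ (landen_down_sq_lt_1 u (proj1 Hu))).
set (B1 := ellB (landen_up u)) in *; set (B2 := ellB (landen_down u)) in *.
unfold landen_down.
replace (1 - u ^ 2) with ((1 - u) * (1 + u)) by ring.
field; repeat split; nra.
Qed.

Definition ln_gpsi (u : R) : R :=
  ln (ellB (landen_up u)) - ln (ellB (landen_down u)) - 2 * ln (1 + u).

Lemma gpsi_exp (u : R) : 0 < u < 1 -> gpsi u = 4 * exp (ln_gpsi u).
Proof.
intros Hu; unfold gpsi, ln_gpsi, Rminus.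
rewrite !exp_plus, !exp_Ropp, Rmult_comm with (r1 := 2).
replace (ln (1 + u) * 2) with (ln (1 + u) + ln (1 + u)) by ring.
assert (H1 := ellB_pos _ (landen_up_sq_lt_1 u Hu)).
assert (H2 := ellB_pos _ (landen_down_sq_lt_1 u (proj1 Hu))).
rewrite exp_plus, !exp_ln by lra.
field; lra.
Qed.

(** The derivative of each modulus is [2 / (1 + u ^ 2)] times the other one, with a minus sign for
    [landen_down]. That sign and the one from the quotient cancel, so both [ellB] terms are
    added. *)
Definition ln_gpsi_deriv (u : R) : R :=
  2 / (1 + u ^ 2) *
    (landen_down u * ellB_deriv (landen_up u) / ellB (landen_up u) +
     landen_up u * ellB_deriv (landen_down u) / ellB (landen_down u))
  - 2 / (1 + u).

Lemma is_derive_ln_ellB_comp (f : R -> R) (u df : R) :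
  is_derive f u df -> f u ^ 2 < 1 ->
  is_derive (fun u => ln (ellB (f u))) u (df * ellB_deriv (f u) / ellB (f u)).
Proof.
intros Hf Hlt; assert (HB := ellB_pos _ Hlt).
evar_last.
- apply (is_derive_comp ln (fun u => ellB (f u))).
  + now apply is_derive_ln.
  + apply (is_derive_comp ellB f); [now apply is_derive_ellB | exact Hf].
- change (df * ellB_deriv (f u) * / ellB (f u) = df * ellB_deriv (f u) / ellB (f u)).
  reflexivity.
Qed.

Lemma is_derive_ln_gpsi (u : R) : 0 < u < 1 -> is_derive ln_gpsi u (ln_gpsi_deriv u).
Proof.
intros Hu.
assert (H1 := landen_up_sq_lt_1 u Hu).
assert (H2 := landen_down_sq_lt_1 u (proj1 Hu)).
assert (HB1 := ellB_pos _ H1); assert (HB2 := ellB_pos _ H2).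
assert (Hup : is_derive landen_up u (2 * landen_down u / (1 + u ^ 2))).
{ unfold landen_up, landen_down; auto_derive; [nra | field; nra]. }
assert (Hdown : is_derive landen_down u (- 2 * landen_up u / (1 + u ^ 2))).
{ unfold landen_up, landen_down; auto_derive; [nra | field; nra]. }
assert (Hln : is_derive (fun u => 2 * ln (1 + u)) u (2 / (1 + u))).
{ auto_derive; [lra | field; lra]. }
evar_last.
- apply @is_derive_minus; [apply @is_derive_minus |].
  + now apply is_derive_ln_ellB_comp; [apply Hup |].
  + now apply is_derive_ln_ellB_comp; [apply Hdown |].
  + apply Hln.
- unfold minus, plus, opp, ln_gpsi_deriv; simpl; field; repeat split; nra.
Qed.

Lemma ln_gpsi_deriv_neg (u : R) : 0 < u < 1 -> ln_gpsi_deriv u < 0.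
Proof.
intros Hu.
assert (H1 := landen_up_sq_lt_1 u Hu).
assert (H2 := landen_down_sq_lt_1 u (proj1 Hu)).
assert (HB1 := ellB_pos _ H1); assert (HB2 := ellB_pos _ H2).
assert (Hl := landen_up_pos u (proj1 Hu)); assert (Hl' := landen_down_pos u Hu).
assert (Hc := landen_complementary u).
assert (Hb1 := ellB_deriv_le _ _ Hl Hc Hl').
rewrite Rplus_comm in Hc; assert (Hb2 := ellB_deriv_le _ _ Hl' Hc Hl).
(* The complementary modulus supplied by the chain rule cancels the one in the denominator of the
   bound, so everything left is rational in [u]. *)
assert (Hkey : forall l l' B dB, 0 < l' -> 0 < B -> dB <= l / (2 * l') * B ->
  l' * dB / B <= l / 2).
{ intros l l' B dB Hpos HB Hle; apply <- Rle_div_l; [| lra].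
  replace (l / 2 * B) with (l' * (l / (2 * l') * B)) by (field; lra).
  apply Rmult_le_compat_l; lra. }
apply Hkey in Hb1; [| assumption | assumption].
apply Hkey in Hb2; [| assumption | assumption].
apply Rle_lt_trans with
  (2 / (1 + u ^ 2) * (landen_up u / 2 + landen_down u / 2) - 2 / (1 + u)).
- apply Rplus_le_compat_r, Rmult_le_compat_l; [| lra].
  apply Rlt_le, Rdiv_lt_0_compat; nra.
- unfold landen_up, landen_down; apply Rminus_lt_0.
  (* The numerator is [1 - 3 * u + 3 * u ^ 2 + u ^ 3 + 2 * u ^ 4]; splitting off [(1 - u) ^ 3] shows
     that it is positive. *)
  match goal with |- 0 < ?e => replace e with
    (((1 - u) ^ 3 + 2 * u ^ 3 + 2 * u ^ 4) / ((1 + u ^ 2) ^ 2 * (1 + u)))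
    by (field; nra) end.
  apply Rdiv_lt_0_compat.
  + generalize (pow_lt (1 - u) 3) (pow_lt u 3) (pow_lt u 4); intros; lra.
  + apply Rmult_lt_0_compat; [apply pow_lt; nra | lra].
Qed.

Lemma gpsi_decreasing (x y : R) : 0 < x -> x < y -> y < 1 -> gpsi y < gpsi x.
Proof.
intros Hx Hxy Hy; rewrite !gpsi_exp by lra.
apply Rmult_lt_compat_l, exp_increasing; [lra |].
destruct (MVT_gen ln_gpsi x y ln_gpsi_deriv) as [c [Hc Heq]].
- intros z; rewrite Rmin_left, Rmax_right by lra; intros Hz.
  apply is_derive_ln_gpsi; lra.
- intros z; rewrite Rmin_left, Rmax_right by lra; intros Hz.
  apply continuity_pt_filterlim, (ex_derive_continuous (V := R_NormedModule)).
  eexists; apply is_derive_ln_gpsi; lra.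
- rewrite Rmin_left, Rmax_right in Hc by lra.
  assert (H := ln_gpsi_deriv_neg c ltac:(lra)); nra.
Qed.

Lemma gpsi_continuous (u : R) : 0 < u < 1 -> continuous gpsi u.
Proof.
intros Hu; apply (continuous_ext_loc _ (fun u => 4 * exp (ln_gpsi u))).
- assert (Hloc : locally u (fun v => 0 < v < 1)).
  { apply (open_and (fun v => 0 < v) (fun v => v < 1));
      [apply open_gt | apply open_lt | exact Hu]. }
  apply filter_imp with (2 := Hloc); intros v Hv; symmetry; now apply gpsi_exp.
- apply (ex_derive_continuous (V := R_NormedModule)); auto_derive.
  eexists; now apply is_derive_ln_gpsi.
Qed.

(** * Behaviour at the ends of the interval and surjectivity *)

Lemma gpsi_between (u a b c d : R) : 0 < u < 1 ->
  0 < a -> 0 < c ->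
  a <= ellB (landen_up u) <= b -> c <= ellB (landen_down u) <= d ->
  4 / (1 + u) ^ 2 * (a / d) <= gpsi u <= 4 / (1 + u) ^ 2 * (b / c).
Proof.
intros Hu Ha Hc Hup Hdown.
assert (H4 : 0 <= 4 / (1 + u) ^ 2)
  by (apply Rlt_le, Rdiv_lt_0_compat; [lra | apply pow_lt; lra]).
split; apply Rmult_le_compat_l; trivial; apply Rmult_le_compat;
  try lra; try (apply Rlt_le, Rinv_0_lt_compat; lra); apply Rinv_le_contravar; lra.
Qed.

(** The lower bound tends to [PI] at 0 and the upper one to [4 / PI] at 1, so values close to both
    ends of the range are attained; this serves surjectivity. *)
Lemma gpsi_coarse_bounds (u : R) : 0 < u < 1 ->
  PI / (1 + u) ^ 2 <= gpsi u <= 16 / (PI * (1 + u) ^ 2).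
Proof.
intros Hu; assert (HPI := PI_RGT_0).
assert (H1 := landen_up_sq_lt_1 u Hu).
assert (H2 := landen_down_sq_lt_1 u (proj1 Hu)).
replace (PI / (1 + u) ^ 2) with (4 / (1 + u) ^ 2 * (PI / 4 / 1)) by (field; lra).
replace (16 / (PI * (1 + u) ^ 2)) with (4 / (1 + u) ^ 2 * (1 / (PI / 4)))
  by (field; lra).
apply gpsi_between; try lra; split;
  first [now apply ellB_ge_PI4 | now apply ellB_le_1].
Qed.

(** Here the upper bound tends to [PI] at 0 and the lower one to [4 / PI] at 1, which confines the
    values to the range. *)
Lemma gpsi_fine_bounds (u : R) : 0 < u < 1 ->
  64 * u ^ 3 / (PI * (1 + u) ^ 2 * (1 + u ^ 2) ^ 2) <= gpsi u <=
  PI * (1 + u ^ 2) ^ 2 / ((1 + u) ^ 3 * (1 - u) ^ 3).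
Proof.
intros Hu; assert (HPI := PI_RGT_0).
assert (Hl := landen_up_pos u (proj1 Hu)); assert (Hl' := landen_down_pos u Hu).
assert (Hc := landen_complementary u).
assert (Hc' := Hc); rewrite Rplus_comm in Hc'.
assert (Hl1 : landen_up u < 1) by nra.
assert (Hl1' : landen_down u < 1) by nra.
replace (64 * u ^ 3 / (PI * (1 + u) ^ 2 * (1 + u ^ 2) ^ 2))
  with (4 / (1 + u) ^ 2 * ((1 - landen_down u) / (PI / 4 / landen_up u))).
2:{ unfold landen_up, landen_down; field; repeat split; nra. }
replace (PI * (1 + u ^ 2) ^ 2 / ((1 + u) ^ 3 * (1 - u) ^ 3))
  with (4 / (1 + u) ^ 2 * ((PI / 4 / landen_down u) / (1 - landen_up u))).
2:{ replace (1 - landen_up u) with ((1 - u) ^ 2 / (1 + u ^ 2))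
      by (unfold landen_up; field; nra).
    unfold landen_down; replace (1 - u ^ 2) with ((1 - u) * (1 + u)) by ring.
    field; repeat split; nra. }
apply gpsi_between; try lra; split;
  first [now apply ellB_ge_sub | now apply ellB_le_div].
Qed.

Lemma continuous_lt_nearby (h : R -> R) (a y : R) :
  continuous h a -> h a < y ->
  exists d : posreal, forall s, Rabs (s - a) < d -> h s < y.
Proof.
intros Hc Hlt; destruct (Hc (fun z => z < y) (open_lt y (h a) Hlt)) as [d Hd].
now exists d; intros s Hs; apply Hd.
Qed.

Lemma exists_right_of_0_lt (h : R -> R) (y e : R) : continuous h 0 -> h 0 < y -> 0 < e ->
  exists s, 0 < s < e /\ h s < y.
Proof.
intros Hc Hlt He; destruct (continuous_lt_nearby h 0 y Hc Hlt) as [d Hd].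
generalize (cond_pos d) (Rmin_l d e) (Rmin_r d e)
  (Rmin_glb_lt d e 0 (cond_pos d) He); intros.
exists (Rmin d e / 2); split; [lra |].
apply Hd; rewrite Rabs_pos_eq; lra.
Qed.

Lemma exists_left_of_1_lt (h : R -> R) (y e : R) : continuous h 1 -> h 1 < y -> e < 1 ->
  exists s, e < s < 1 /\ h s < y.
Proof.
intros Hc Hlt He.
destruct (exists_right_of_0_lt (fun x => h (1 - x)) y (1 - e)) as [s [Hs Hh]].
- apply (continuous_comp (fun x => 1 - x) h).
  + apply (ex_derive_continuous (V := R_NormedModule)); auto_derive; exact I.
  + now rewrite Rminus_0_r.
- now rewrite Rminus_0_r.
- lra.
- exists (1 - s); split; [lra | exact Hh].
Qed.

Lemma gpsi_lt_PI (u : R) : 0 < u < 1 -> gpsi u < PI.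
Proof.
intros Hu; apply Rnot_le_lt; intros Hle.
(* Moving to [u / 2] makes the excess over [PI] strict; the upper bound near 0 then falls below
   [gpsi (u / 2)], against monotonicity. *)
assert (Hdec := gpsi_decreasing (u / 2) u ltac:(lra) ltac:(lra) ltac:(lra)).
destruct (exists_right_of_0_lt (fun s => PI * (1 + s ^ 2) ^ 2 / ((1 + s) ^ 3 * (1 - s) ^ 3))
  (gpsi (u / 2)) (u / 2)) as [s [Hs Hh]].
- apply (ex_derive_continuous (V := R_NormedModule)); auto_derive; lra.
- replace (PI * _ / _) with PI by field; lra.
- lra.
- assert (H := gpsi_fine_bounds s ltac:(lra)).
  assert (H2 := gpsi_decreasing s (u / 2) ltac:(lra) ltac:(lra) ltac:(lra)); lra.
Qed.

Lemma gpsi_gt_4_div_PI (u : R) : 0 < u < 1 -> 4 / PI < gpsi u.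
Proof.
intros Hu; apply Rnot_le_lt; intros Hle.
set (v := (u + 1) / 2).
assert (Hdec := gpsi_decreasing u v ltac:(lra) ltac:(unfold v; lra) ltac:(unfold v; lra)).
(* Negation turns the lower bound, whose limit at 1 is [4 / PI], into a quantity to be kept below a
   level. *)
destruct (exists_left_of_1_lt (fun s => - (64 * s ^ 3 / (PI * (1 + s) ^ 2 * (1 + s ^ 2) ^ 2)))
  (- gpsi v) v) as [s [Hs Hh]].
- apply (ex_derive_continuous (V := R_NormedModule)); auto_derive.
  generalize PI_RGT_0; intros.
  repeat first [lra | apply Rmult_integral_contrapositive_currified].
- replace (64 * _ / _) with (4 / PI) by (field; generalize PI_RGT_0; lra); lra.
- unfold v; lra.
- assert (Hv : u < v) by (unfold v; lra).
  assert (H := gpsi_fine_bounds s ltac:(lra)).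
  assert (H2 := gpsi_decreasing v s ltac:(lra) ltac:(lra) ltac:(lra)); lra.
Qed.

Lemma gpsi_surjective (y : R) : 4 / PI < y < PI ->
  exists u, 0 < u < 1 /\ gpsi u = y.
Proof.
intros Hy; assert (HPI := PI_RGT_0).
destruct (exists_right_of_0_lt (fun s => - (PI / (1 + s) ^ 2)) (- y) 1) as [a [Ha Hya]].
- apply (ex_derive_continuous (V := R_NormedModule)); auto_derive; lra.
- replace (PI / _) with PI by field; lra.
- lra.
- destruct (exists_left_of_1_lt (fun s => 16 / (PI * (1 + s) ^ 2)) y a) as [b [Hb Hyb]].
  + apply (ex_derive_continuous (V := R_NormedModule)); auto_derive.
    repeat first [lra | apply Rmult_integral_contrapositive_currified].
  + replace (16 / _) with (4 / PI) by (field; lra); lra.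
  + lra.
  + assert (HA := gpsi_coarse_bounds a ltac:(lra)).
    assert (HB := gpsi_coarse_bounds b ltac:(lra)).
    (* Subtracting [gpsi] from [y] gives the sign change from negative to positive that the
       intermediate value theorem expects. *)
    destruct (IVT_interv (fun u => y - gpsi u) a b) as [u [Hu Heq]].
    * intros c Hc; apply continuity_pt_filterlim.
      apply (continuous_minus (V := R_NormedModule)); [apply continuous_const |].
      apply gpsi_continuous; lra.
    * lra.
    * lra.
    * lra.
    * exists u; lra.
Qed.

Lemma sqrt_in_unit (r : R) : 0 < r < 1 -> 0 < sqrt r < 1 /\ sqrt r ^ 2 = r.
Proof.
intros Hr; repeat split.
- apply sqrt_lt_R0; lra.
- rewrite <- sqrt_1; apply sqrt_lt_1_alt; lra.
- apply pow2_sqrt; lra.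
Qed.

Lemma fpsi_gpsi_sqrt (r : R) : 0 < r < 1 -> fpsi r = gpsi (sqrt r).
Proof.
intros Hr; destruct (sqrt_in_unit r Hr) as [Hu Hu2].
rewrite <- fpsi_gpsi by exact Hu; now rewrite Hu2.
Qed.

Lemma fpsi_bounds (r : R) : 0 < r < 1 -> 4 / PI < fpsi r < PI.
Proof.
intros Hr; rewrite fpsi_gpsi_sqrt by exact Hr.
destruct (sqrt_in_unit r Hr) as [Hu _].
split; [now apply gpsi_gt_4_div_PI | now apply gpsi_lt_PI].
Qed.

Theorem theorem1p8 :
  (forall x y : R, 0 < x -> x < y -> y < 1 -> fpsi y < fpsi x) /\
  (forall y : R, (exists r : R, 0 < r < 1 /\ fpsi r = y) <-> 4 / PI < y < PI) /\
  (forall r : R, 0 < r < 1 ->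
     4 * r / (PI * (1 - sqrt r) ^ 2) < psi r < PI * r / (1 - sqrt r) ^ 2).
Proof.
split; [| split].
- intros x y Hx Hxy Hy; rewrite !fpsi_gpsi_sqrt by lra.
  apply gpsi_decreasing.
  + now apply sqrt_lt_R0.
  + apply sqrt_lt_1_alt; lra.
  + now apply (sqrt_in_unit y); lra.
- intros y; split.
  + intros [r [Hr <-]]; now apply fpsi_bounds.
  + intros Hy; destruct (gpsi_surjective y Hy) as [u [Hu Heq]].
    exists (u ^ 2); split; [nra |]; now rewrite fpsi_gpsi.
- intros r Hr; assert (HPI := PI_RGT_0).
  destruct (sqrt_in_unit r Hr) as [Hu _].
  destruct (fpsi_bounds r Hr) as [Hlo Hhi].
  assert (Hpos : 0 < r / (1 - sqrt r) ^ 2)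
    by (apply Rdiv_lt_0_compat; [lra | apply pow_lt; lra]).
  assert (Heq : psi r = fpsi r * (r / (1 - sqrt r) ^ 2))
    by (unfold fpsi; field; lra).
  rewrite Heq; split.
  + replace (4 * r / (PI * (1 - sqrt r) ^ 2)) with (4 / PI * (r / (1 - sqrt r) ^ 2))
      by (field; lra).
    now apply Rmult_lt_compat_r.
  + replace (PI * r / (1 - sqrt r) ^ 2) with (PI * (r / (1 - sqrt r) ^ 2))
      by (field; lra).
    now apply Rmult_lt_compat_r.
Qed.
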